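(* Every additive-chore instance admits a $\frac43$-PMMS allocation. Consequently, $\rho^{\star}_{\mathrm{PMMS}}\le\frac43$.
   Context: An additive-chore instance consists of a finite set $N=[n]$ of agents, a finite set $M$ of indivisible chores, and for each agent $i$ an additive cost function $c_i:2^M\to\mathbb{R}_{\ge0}$. An allocation $X=(X_i)_{i\in N}$ is a partition of $M$ into $n$ (possibly empty) bundles. For $S\subseteq M$, $\mu^{\mathrm C}_i(2,S)=\min_{(P_1,P_2)\in\Pi_2(S)}\max\{c_i(P_1),c_i(P_2)\}$, where $\Pi_2(S)$ is the set of ordered bipartitions of $S$ (parts may be empty). For $\rho\ge1$, an allocation $X$ is $\rho$-PMMS if $c_i(X_i)\le\rho\,\mu^{\mathrm C}_i(2,X_i\cup X_j)$ for all $i\ne j$. The PMMS factor of an allocation is $\rho(X)=\max\{c_i(X_i)/\mu^{\mathrm C}_i(2,X_i\cup X_j): i\neq j,\ \mu^{\mathrm C}_i(2,X_i\cup X_j)>0\}$ (with the maximum over an empty set taken to be $0$); the optimal factor of an instance $I$ is $\rho^\star(I)=\min_X\rho(X)$ over all allocations; and $\rho^{\star}_{\mathrm{PMMS}}=\sup_I\rho^\star(I)$ over all additive-chore instances $I$. *)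

(* Defs.v *)
From mathcomp Require Import all_boot all_order all_algebra.
From mathcomp Require Import all_classical all_reals ereal.

Set Implicit Arguments.
Unset Strict Implicit.
Unset Printing Implicit Defensive.

Import Order.TTheory GRing.Theory Num.Theory.

Local Open Scope ring_scope.

(* Without agents a nonempty set of chores has no allocation, so that
   [opt_factor] would be a minimum over the empty set: hence
   [instance_agents_gt0]. *)
Record instance (R : realType) := Instance {
  nb_agents : nat;
  chore : finType;
  cost : 'I_nb_agents -> {set chore} -> R;
  instance_agents_gt0 : (0 < nb_agents)%N;
  cost_ge0 : forall i S, 0 <= cost i S;
  cost_additive : forall i S, cost i S = \sum_(x in S) cost i [set x] }.

Definition agent (R : realType) (I : instance R) : finType :=
  'I_(nb_agents I).

Definition bundles (R : realType) (I : instance R) : finType :=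
  {ffun agent I -> {set chore I}}.

Definition is_allocation (R : realType) (I : instance R) (X : bundles I) :
    bool :=
  (\bigcup_i X i == [set: chore I])
  && [forall i, forall j, (i != j) ==> [disjoint X i & X j]].

Definition is_bipartition (T : finType) (S : {set T})
    (P : {set T} * {set T}) : bool :=
  (P.1 :|: P.2 == S) && [disjoint P.1 & P.2].

Definition bipartition_cost (R : realType) (I : instance R) (i : agent I)
    (P : {set chore I} * {set chore I}) : R :=
  Num.max (cost i P.1) (cost i P.2).

(* [(S, set0)] is only the witness of nonemptiness that [arg min] needs. *)
Definition mu2 (R : realType) (I : instance R) (i : agent I)
    (S : {set chore I}) : R :=
  bipartition_cost i
    [arg min_(P < (S, finset.set0) | is_bipartition S P) bipartition_cost i P]%O.

Definition is_PMMS (R : realType) (I : instance R) (rho : R)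
    (X : bundles I) : Prop :=
  forall i j : agent I, i != j -> cost i (X i) <= rho * mu2 i (X i :|: X j).

(* The ratios are nonnegative, so the neutral element 0 only matters when no
   pair of agents qualifies. *)
Definition PMMS_factor (R : realType) (I : instance R) (X : bundles I) : R :=
  \big[Num.max/0]_(ij : agent I * agent I |
      (ij.1 != ij.2) && (0 < mu2 ij.1 (X ij.1 :|: X ij.2)))
    (cost ij.1 (X ij.1) / mu2 ij.1 (X ij.1 :|: X ij.2)).

(* Everything to agent 0; only the witness of nonemptiness in [opt_factor]. *)
Definition trivial_allocation (R : realType) (I : instance R) : bundles I :=
  [ffun i : agent I =>
     if i == Ordinal (instance_agents_gt0 I) then [set: chore I] else finset.set0].

Definition opt_factor (R : realType) (I : instance R) : R :=
  PMMS_factor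
    [arg min_(X < trivial_allocation I | is_allocation X) PMMS_factor X]%O.

(* The supremum is taken in the extended reals: the real-valued [sup] is 0 on
   unbounded sets. *)
Definition rho_star_PMMS (R : realType) : \bar R :=
  ereal_sup
    [set x : \bar R | exists I : instance R, x = (opt_factor I)%:E]%classic.

(* Main.v *)
Require Import Defs.
From mathcomp Require Import all_boot all_order all_algebra.
From mathcomp Require Import all_classical all_reals ereal.
From mathcomp Require Import topology normedtype derive zify ring lra.
From mathcomp Require Import fintype finset.

(* The allocation is found among those in which every agent holds at most one
   chore, or finds no other bundle cheaper than half of its own.  Both cases give
   4/3: mu is at least the cost of each single chore, and at least half of the
   total cost.

   Perturb the costs so that they are positive and satisfy no multiplicative
   relation.  For weights v, give each chore x the price p(x) = min_i c_i(x) / v_i.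
   A Scarf-type lemma (a KKM argument over the simplex of weights) yields v such
   that, for every agent k, some way of giving each chore to an agent attaining its
   price makes k a least earner.  Let L be the largest of these least earnings.
   Then the chores that only k can take at their price are worth at most L, for
   every k, and some assignment pays everybody at least L.  By genericity the ties
   form a forest, so shared chores can be pushed towards its leaves until everybody
   earns at most L after removal of one chore, while still earning at least L.

   Finally an agent i who is unhappy with R + {g}, where p(R) <= L, takes R together
   with the bundle X_j that it finds cheapest and hands {g} alone to j.  Doing this
   by increasing p(g) leaves the earlier agents happy, because c_i / v_i >= p. *)

Set Implicit Arguments.
Unset Strict Implicit.
Unset Printing Implicit Defensive.

Import Order.TTheory GRing.Theory Num.Theory.
Import numFieldNormedType.Exports.

Local Open Scope ring_scope.

Lemma redundant_pair (U V : finType) (f : U -> V) (A : {set U}) (B : {set V}) :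
  f @: A = B -> #|A| = #|B|.+1 ->
  exists a b : U, [/\ a != b, a \in A, b \in A, f a = f b &
    [set x in A | f @: (A :\ x) == B] = [set a; b]].
Proof.
move=> fAB cAB.
have : ~~ dinjectiveb f A.
  apply/negP=> /dinjectiveP/card_in_imset; rewrite fAB cAB; lia.
case/dinjectivePn=> a aA [b] /andP[/= ba bA] fab.
have fD1 x y : x \in A -> y \in A -> x != y -> f x = f y -> f @: (A :\ x) = B.
  move=> xA yA xy fxy; rewrite -fAB; apply/setP=> v; apply/imsetP/imsetP.
    by case=> z /setD1P[_ zA] ->; exists z.
  case=> z zA ->; have [->|zx] := eqVneq z x.
    by exists y => //; rewrite !inE yA eq_sym xy.
  by exists z => //; rewrite !inE zx.
have inja : {in A :\ a &, injective f}.
  apply/imset_injP; rewrite (fD1 a b) // 1?eq_sym //.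
  by rewrite (cardsD1 a A) aA in cAB; apply/eqP; lia.
exists a, b; split=> //; first by rewrite eq_sym.
apply/setP=> x; rewrite !inE; apply/andP/orP => [[xA /eqP fx]|].
  have [->|xa] := eqVneq x a; first by left.
  right; have : f x \in f @: (A :\ x) by rewrite fx -fAB imset_f.
  case/imsetP=> z /setD1P[zx zA] fxz.
  have [za|za] := eqVneq z a.
    by apply/eqP/inja; rewrite ?inE ?xa ?ba // fxz za.
  by case/eqP: zx; apply: inja; rewrite ?inE ?za ?xa.
by case=> /eqP->; split=> //; apply/eqP; [apply: (fD1 a b) | apply: (fD1 b a)];
  rewrite // eq_sym.
Qed.

(** * Dominant sets and Scarf's lemma *)

Section Dominance.
Local Open Scope nat_scope.
Variables (V I : finType) (r : I -> V -> nat).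
Hypothesis r_inj : forall i, injective (r i).

(** Scarf's dominance: no point lies strictly above the minimum of [S] in all orders at once. *)
Definition dominant (S : {set V}) :=
  [forall y, exists i, forall s in S, r i y <= r i s].

Lemma dominantP (S : {set V}) :
  reflect (forall y, exists i, {in S, forall s, r i y <= r i s}) (dominant S).
Proof.
apply: (iffP forallP) => h y; have := h y.
  by case/existsP=> i /forall_inP hi; exists i.
by case=> i hi; apply/existsP; exists i; apply/forall_inP.
Qed.

Lemma dominantS (S S' : {set V}) : S \subset S' -> dominant S' -> dominant S.
Proof.
move=> sub /dominantP dS; apply/dominantP=> y.
by have [i hi] := dS y; exists i => s /(subsetP sub); apply: hi.
Qed.

(** Pivot step. By dominance every point of [S] is the minimum of some order, so exactly two orders
    share theirs; a new point can only become the minimum of one of these two. [ext] makes both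
    pivots available. *)
Lemma dominant_extensions (S : {set V}) :
  dominant S -> #|S|.+1 = #|I| -> S != set0 ->
  (forall a, [exists y, forall i, (i != a) ==> [exists s in S, r i s < r i y]] ) ->
  #|[set y | (y \notin S) && dominant (y |: S)]| = 2.
Proof.
move=> dS cS /set0Pn[s0 s0S] ext.
pose m i := [arg min_(s < s0 in S) r i s].
have mS i : m i \in S by rewrite /m; case: arg_minnP.
have mmin i s : s \in S -> r i (m i) <= r i s.
  by rewrite /m; case: arg_minnP => // ? _ h; apply: h.
have mimg : m @: [set: I] = S.
  apply/setP=> s; apply/imsetP/idP => [[i _ ->] //|sS].
  have [i hi] := dominantP _ dS s; exists i => //.
  by apply: (@r_inj i); apply/eqP; rewrite eqn_leq hi ?mmin.
have [|a [b [ab _ _ mab fr]]] := redundant_pair mimg; first by rewrite cardsT.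
(* [S] extends by [y] exactly when [y] is the [c]-largest point of [M c], for one
   of the two indices [c] sharing their minimum over [S]. *)
pose M c := [pred y | [forall i, (i != c) ==> (r i (m i) < r i y)]].
have M0 c : exists y, M c y.
  have /existsP[y hy] := ext c; exists y; apply/forallP=> i; apply/implyP=> ic.
  have /existsP[s /andP[sS]] := implyP (forallP hy i) ic.
  by apply: leq_ltn_trans; apply: mmin.
have Mtop c : exists y, M c y /\ forall z, M c z -> r c z <= r c y.
  have [y0 y0M] := M0 c; exists [arg max_(y > y0 | M c y) r c y].
  by case: arg_maxnP.
have [ya [yaM yamax]] := Mtop a; have [yb [ybM ybmax]] := Mtop b.
have Mnotdom c y i : M c y -> {in S, forall s, r i y <= r i s} -> i = c.
  move=> yM h; apply/eqP; apply: contraT => ic.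
  by have := implyP (forallP yM i) ic; rewrite ltnNge h.
have Mle c y : M c y -> {in S, forall s, r c y <= r c s}.
  by move=> yM; have [i hi] := dominantP _ dS y; rewrite -(Mnotdom _ _ _ yM hi).
have yab : ya != yb.
  apply/eqP=> E; have := implyP (forallP yaM b); rewrite eq_sym ab => /(_ isT).
  by rewrite E ltnNge Mle.
have Mnew c y : c = a \/ c = b -> M c y -> y \notin S.
  move=> cab yM; apply/negP => yS.
  have yc : y = m c.
    by apply: (@r_inj c); apply/eqP; rewrite eqn_leq mmin // Mle.
  case: cab => cE; subst c.
    have := implyP (forallP yM b); rewrite eq_sym ab => /(_ isT).
    by rewrite yc mab ltnn.
  by have := implyP (forallP yM a) ab; rewrite yc -mab ltnn.
have dom c y : c = a \/ c = b -> M c y -> (forall z, M c z -> r c z <= r c y) ->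
    dominant (y |: S).
  move=> cab yM ymax; apply/dominantP=> z.
  case zM: (M c z).
    exists c => s; rewrite !inE => /predU1P[->|]; first exact: ymax.
    by move=> sS; apply: (Mle c).
  move/negbT: zM; rewrite negb_forall => /existsP[i]; rewrite negb_imply -leqNgt.
  case/andP=> ic le; exists i => s; rewrite !inE => /predU1P[->|sS].
    by rewrite ltnW // (leq_ltn_trans le) // (implyP (forallP yM i)).
  exact: leq_trans le (mmin _ _ sS).
suff -> : [set y | (y \notin S) && dominant (y |: S)] = [set ya; yb].
  by rewrite cards2 yab.
apply/setP=> y; rewrite !inE; apply/andP/orP; last first.
  by case=> /eqP->; split; [apply: (Mnew a) => //; left | apply: (dom a) => //; left
    | apply: (Mnew b) => //; right | apply: (dom b) => //; right].
case=> yS dy.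
(* Conversely, [y] is the minimum of [y |: S] in some order [c], and each point of [S] must still be
   minimal in another order: dropping [c] loses nothing, so [c] is [a] or [b]. *)
have [c hc] := dominantP _ dy y.
have hcS : {in S, forall s, r c y <= r c s} by move=> s sS; apply: hc; rewrite !inE sS orbT.
have surj s : s \in S -> exists2 i, i != c & m i = s /\ r i s <= r i y.
  move=> sS; have [i hi] := dominantP _ dy s; exists i.
    apply: contraNneq yS => ic; subst i.
    suff -> : y = s by [].
    apply: (@r_inj c); apply/eqP.
    by rewrite eqn_leq hcS ?hi // !inE eqxx.
  split; last by apply: hi; rewrite !inE eqxx.
  by apply: (@r_inj i); apply/eqP; rewrite eqn_leq mmin // hi // !inE mS orbT.
have mc : m @: ([set: I] :\ c) = S.
  apply/setP=> s; apply/imsetP/idP => [[i _ ->] //|sS].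
  by have [i ic [<- _]] := surj s sS; exists i; rewrite ?inE ?ic.
have cab : c = a \/ c = b.
  have : c \in [set a; b] by rewrite -fr !inE mc eqxx.
  by rewrite !inE => /orP[]/eqP; [left | right].
have minj : {in [set: I] :\ c &, injective m}.
  by apply/imset_injP; rewrite mc; have := cardsD1 c [set: I]; rewrite inE cardsT; lia.
have yM : M c y.
  apply/forallP=> i; apply/implyP => ic.
  have [j jc [mj le]] := surj (m i) (mS i).
  have ij : j = i by apply: minj; rewrite ?inE ?jc ?ic.
  rewrite ij in le; rewrite ltn_neqAle le andbT.
  by apply: contraNneq yS => /(@r_inj i) <-.
have ymax z : M c z -> r c z <= r c y.
  move=> zM; have [i hi] := dominantP _ dy z.
  rewrite -(Mnotdom c z i) //; first by apply: hi; rewrite !inE eqxx.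
  by move=> s sS; apply: hi; rewrite !inE sS orbT.
case: cab => cE; subst c; [left | right]; apply/eqP.
  by apply: (@r_inj a); apply/eqP; rewrite eqn_leq ymax // yamax.
by apply: (@r_inj b); apply/eqP; rewrite eqn_leq ymax // ybmax.
Qed.
End Dominance.

Section Scarf.
Local Open Scope nat_scope.
Variables (T I : finType) (r : I -> T -> nat) (col : T -> I).
Hypothesis r_inj : forall i, injective (r i).

(* The extra point [inr j] lies below everything in the order [j] and above
   [T] in the other orders: a set [S] of points encodes the pair made of its
   trace on [T] and of the indices [j] such that [inr j] is not in [S]. *)
Let big := \sum_i \sum_t r i t.
Let rx (i : I) (v : T + I) : nat :=
  match v with
  | inl t => (r i t).+1
  | inr j => if j == i then 0 else (big + enum_rank j).+2
  end.
Let colx (v : T + I) : I := match v with inl t => col t | inr j => j end.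

Let r_big i t : r i t <= big.
Proof. by rewrite /big (bigD1 i) //= (bigD1 t) //= -addnA leq_addr. Qed.

Let rx_inj i : injective (rx i).
Proof.
move=> [t|j] [u|k] /=; have := @r_big i.
- by move=> _ [] /r_inj ->.
- by move=> /(_ t); case: eqP => // _ ? [] ?; lia.
- by move=> /(_ u); case: eqP => // _ ? [] ?; lia.
move=> _; case: eqP => [->|_]; case: eqP => [->|_] // [] /addnI/val_inj/enum_rank_inj -> //.
Qed.

Let dominant_slack (S : {set T + I}) (t : T) i :
  {in S, forall s, rx i (inl t) <= rx i s} -> inr i \notin S.
Proof. by move=> h; apply/negP => /h /=; rewrite eqxx. Qed.

(** A combinatorial substitute for the KKM lemma: with coordinates as orders and a labelling as
    [col], [D] will become a cluster of nearby points that shows all labels of [C]. *)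
Theorem scarf (t0 : T) (i0 : I) : exists (D : {set T}) (C : {set I}),
  [/\ C != set0,
      forall y, exists2 i, i \in C & {in D, forall d, r i y <= r i d}
    & C \subset col @: D].
Proof.
suff [S [dS cS]] : exists S : {set T + I}, dominant rx S /\ colx @: S = setT.
  exists [set t | inl t \in S], [set i | inr i \notin S]; split.
  - have [i /dominant_slack iS] := dominantP _ _ dS (inl t0).
    by apply/set0Pn; exists i; rewrite inE.
  - move=> y; have [i hi] := dominantP _ _ dS (inl y).
    exists i; first by rewrite inE (dominant_slack hi).
    by move=> d; rewrite inE => /hi.
  - apply/subsetP=> i; rewrite inE => iS.
    have : i \in colx @: S by rewrite cS.
    case/imsetP=> -[t|j] vS /= ij; first by rewrite ij imset_f ?inE.
    by rewrite ij vS in iS.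
(* Parity: a dominant set of size #|I| without the color [i0] contains exactly two
   sets that take every other color once; each of these has two dominant
   extensions, except [S0] which has one. *)
pose S0 : {set T + I} := [set inr j | j in [set~ i0]].
pose tm := [arg max_(t > t0) r i0 t].
have tmP t : r i0 t <= r i0 tm by rewrite /tm; case: arg_maxnP => // ? _; apply.
have inS0 j : (inr j \in S0) = (j != i0).
  apply/imsetP/idP => [[k]|ji]; first by rewrite !inE => ki [->].
  by exists j; rewrite ?inE.
have inlS0 t : (inl t \in S0) = false by apply/negP=> /imsetP[].
have dS0 : dominant rx (inl tm |: S0).
  apply/dominantP=> -[t|j]; last by exists j => s _ /=; rewrite eqxx.
  exists i0 => -[u|j]; rewrite !inE ?inS0 ?inlS0 ?orbF /=.
    by move=> /eqP[->]; rewrite ltnS tmP.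
  by move/negbTE->; have := r_big i0 t; lia.
have extS0 : [set y | (y \notin S0) && dominant rx (y |: S0)] = [set inl tm].
  apply/setP=> y; rewrite !inE; apply/andP/eqP => [[yS /dominantP/(_ (inl tm))[i hi]]|->];
    last by rewrite inlS0.
  have := dominant_slack hi; rewrite !inE inS0 negb_or negbK => /andP[yi /eqP ii0].
  subst i; case: y yS hi {yi} (yi) => [t|j] yS hi yi.
    have := hi (inl t); rewrite !inE eqxx => /(_ isT) /=; rewrite ltnS => le.
    by congr inl; apply: (@r_inj i0); apply/eqP; rewrite eqn_leq le tmP.
  by move: yS yi; rewrite inS0 negbK => /eqP->; rewrite eqxx.
pose Dr := [set S | [&& dominant rx S, #|S|.+1 == #|I| & colx @: S == [set~ i0]]].
pose Rm := [set S | [&& dominant rx S, #|S| == #|I| & [set~ i0] \subset colx @: S]].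
have [S /and3P[_ dS /eqP cS]|noRm] := pickP (fun S : {set T + I} =>
    [&& S \in Rm, dominant rx S & colx @: S == setT]).
  by exists S.
have S0Dr : S0 \in Dr.
  rewrite inE (dominantS (subsetUr _ _) dS0) card_imset; last by move=> ? ? [].
  rewrite cardsC1 prednK ?eqxx //=; last by apply/card_gt0P; exists i0.
  apply/eqP/setP=> j; apply/imsetP/idP => [[v /imsetP[k ki ->] ->] //|ji].
  by exists (inr j); rewrite ?inS0 //; rewrite !inE in ji.
have : \sum_(S in Dr) #|[set y | (y \notin S) && dominant rx (y |: S)]| =
       \sum_(S in Rm) #|[set x in S | colx @: (S :\ x) == [set~ i0]]|.
  under eq_bigr do rewrite -sum1_card.
  under [in RHS]eq_bigr do rewrite -sum1_card.
  rewrite !pair_big_dep /=.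
  rewrite (reindex_onto (fun p => (p.1 :\ p.2, p.2)) (fun p => (p.2 |: p.1, p.2))) /=.
    apply: eq_bigl => -[S x] /=; rewrite !inE /=.
    have [xS|xS] := boolP (x \in S); last first.
      rewrite [RHS]andbF; apply/negP => /andP[_ /eqP[E]].
      by rewrite -E setU11 in xS.
    rewrite setD1K // eqxx eqxx /= !andbT (cardsD1 x S) xS add1n.
    apply/andP/andP => -[/and3P[h1 h2 h3] h4].
      by rewrite h4 h2 h3 -(eqP h3) imsetS // subD1set.
    by rewrite h1 h2 h4 (dominantS (subD1set _ _) h1).
  move=> [S y] /=; rewrite !inE => /and3P[_ yS _].
  by rewrite setU1K.
rewrite (bigD1 S0) //= extS0 cards1.
rewrite (eq_bigr (fun=> 2)).
  rewrite [RHS](eq_bigr (fun=> 2)); first by rewrite !sum_nat_const; lia.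
  move=> S SR; have := noRm S; rewrite /= SR /= => /negbT.
  move: SR; rewrite !inE => /and3P[-> /eqP cS sub] /= nT.
  have E : colx @: S = [set~ i0].
    apply/eqP; rewrite eqEsubset sub andbT subsetC sub1set inE.
    apply: contra nT => i0S; apply/eqP/setP=> j; rewrite inE.
    by have [->//|ji] := eqVneq j i0; apply: (subsetP sub); rewrite !inE.
  have [|a [b [ab _ _ _ ->]]] := redundant_pair E; last by rewrite cards2 ab.
  by rewrite cS cardsC1 prednK //; apply/card_gt0P; exists i0.
move=> S /andP[]; rewrite inE => /and3P[dS /eqP cS /eqP colS] neS.
(* Away from [S0] the set meets [T], and [inr a], above [T] in every order but [a], serves as the
   point that [ext] asks for. *)
have [t /= tS|noT] := pickP [pred t | inl t \in S].
  apply: (dominant_extensions rx_inj) => //; first by apply/set0Pn; exists (inl t).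
  move=> a; apply/existsP; exists (inr a); apply/forallP=> i; apply/implyP=> ia.
  apply/existsP; exists (inl t); rewrite tS /= eq_sym (negbTE ia).
  by have := r_big i t; lia.
case/eqP: neS; apply/setP=> -[t|j]; first by rewrite inlS0; apply: noT.
rewrite inS0; transitivity (j \in [set~ i0]); last by rewrite !inE.
rewrite -colS; apply/idP/imsetP => [jS|[[t|k] vS /= ->] //]; first by exists (inr j).
by have := noT t; rewrite /= vS.
Qed.
End Scarf.

(** * Rounding along a forest of ties *)

Section Rounding.
Variables (R : realFieldType) (A M : finType).

(** The hypothesis says that ties form a forest: some agent of every [C] is linked to the rest of
    [C] through at most one chore. Stripping such an agent first, and repeating, orders the agents
    so that each shares at most one chore with later ones. *)
Lemma elimination_rank (N : M -> {set A}) :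
  (forall C : {set A}, C != set0 -> exists2 c, c \in C &
     forall x y j j', c \in N x -> c \in N y -> j \in N x :&: C ->
       j' \in N y :&: C -> j != c -> j' != c -> x = y) ->
  exists2 rank : A -> nat, injective rank &
    forall c x y j j', c \in N x -> c \in N y -> j \in N x -> j' \in N y ->
      (rank c < rank j)%N -> (rank c < rank j')%N -> x = y.
Proof.
move=> degen.
suff H m (C : {set A}) : (#|C| <= m)%N -> exists2 rank : A -> nat,
    {in C &, injective rank} &
    {in C, forall c, forall x y j j', c \in N x -> c \in N y ->
      j \in N x :&: C -> j' \in N y :&: C ->
      (rank c < rank j)%N -> (rank c < rank j')%N -> x = y}.
  have [rank rinj rP] := H #|A| [set: A] (max_card _).
  exists rank => [i j|c x y j j' cx cy jx jy]; first by apply: rinj; rewrite inE.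
  by apply: rP; rewrite ?inE ?andbT.
elim: m C => [|m IH] C leC.
  exists (fun=> 0%N) => i; move: leC; rewrite leqn0 cards_eq0 => /eqP->; by rewrite inE.
have [->|C0] := eqVneq C set0; first by exists (fun=> 0%N) => i; rewrite inE.
have [c cC cP] := degen C C0.
have [|rank rinj rP] := IH (C :\ c); first by rewrite (cardsD1 c C) cC in leC.
exists (fun i => if i == c then 0%N else (rank i).+1).
  move=> i j iC jC; have [->|ic] := eqVneq i c; have [->|jc] := eqVneq j c => // -[].
  by apply: rinj; rewrite !inE ?ic ?jc.
move=> k kC x y j j' kx ky; rewrite !inE => /andP[jx jC] /andP[jy j'C].
have [_|jc] := eqVneq j c; first by rewrite ltn0.
have [_|j'c] := eqVneq j' c; first by rewrite ltn0.
have [kc|kc] := eqVneq k c.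
  by subst k => _ _; apply: (cP x y j j'); rewrite ?inE ?jx ?jy.
by rewrite !ltnS; apply: rP; rewrite ?inE ?kc ?jc ?j'c ?jx ?jy.
Qed.

(** In an assignment of least total rank, consider the shared chores held by [k]. If [k] is the last
    of the possible takers of one, passing it on would lower the rank, so it cannot be spared: the
    rest is worth at most [L]. Otherwise each of them leads to a later agent, so there is at most
    one, and without it only chores exclusive to [k] remain. *)
Lemma rounding (N : M -> {set A}) (p : M -> R) (L : R) (rank : A -> nat) (X : M -> A) :
  (forall x, 0 <= p x) -> (forall x, X x \in N x) ->
  (forall k, L <= \sum_(x | X x == k) p x) ->
  (forall k, \sum_(x | N x == [set k]) p x <= L) ->
  injective rank ->
  (forall c x y j j', c \in N x -> c \in N y -> j \in N x -> j' \in N y ->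
      (rank c < rank j)%N -> (rank c < rank j')%N -> x = y) ->
  exists Y : M -> A, [/\ forall x, Y x \in N x,
    forall k, L <= \sum_(x | Y x == k) p x &
    forall k, \sum_(x | Y x == k) p x <= L \/
      exists2 g, Y g = k & \sum_(x | (Y x == k) && (x != g)) p x <= L].
Proof.
move=> p0 XN XL aL rinj rP.
(* Minimising the total rank moves shared chores to the earliest agents. *)
pose feas (f : {ffun M -> A}) :=
  [forall x, f x \in N x] && [forall k, L <= \sum_(x | f x == k) p x].
have feasX : feas (finfun X).
  apply/andP; split; apply/forallP => ?; first by rewrite ffunE.
  by under eq_bigl do rewrite ffunE.
case: (arg_minnP (fun f : {ffun M -> A} => \sum_x rank (f x))%N feasX) => Y
  /andP[/forallP YN /forallP YL] Ymin.
exists Y; split=> // k.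
pose tie x := (Y x == k) && (N x != [set k]).
have strict (Q : pred M) : (forall x, Q x -> N x = [set k]) -> \sum_(x | Q x) p x <= L.
  move=> QN; apply: le_trans (aL k).
  rewrite [leRHS](bigID Q) /= -[leLHS]addr0 lerD //; last by apply: sumr_ge0.
  rewrite le_eqVlt; apply/orP; left; apply/eqP/eq_bigl => x.
  by have [/QN ->|] := boolP (Q x); rewrite ?eqxx ?andbF.
have [x|noex] := pickP [pred x | tie x && [forall j in N x, (rank j <= rank k)%N]].
  case/andP=> /andP[/eqP Yx Nx] /forall_inP early.
  have [j jN jk] : exists2 j, j \in N x & j != k.
    apply/exists_inP; apply: contraNT Nx; rewrite negb_exists_in => /forall_inP h.
    rewrite eqEsubset sub1set -{2}Yx YN andbT; apply/subsetP=> j /h.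
    by rewrite negbK inE.
  have [le|gt] := leP (\sum_(y | (Y y == k) && (y != x)) p y) L.
    by right; exists x.
  exfalso; pose Z := [ffun y => if y == x then j else Y y].
  have : feas Z.
    apply/andP; split; apply/forallP=> h.
      by rewrite ffunE; case: eqP => [->|_].
    have [->|hk] := eqVneq h k.
      apply: le_trans (ltW gt) _; rewrite le_eqVlt; apply/orP; left; apply/eqP/eq_bigl=> y.
      by rewrite ffunE; have [_|_] := eqVneq y x; rewrite /= ?(negbTE jk) ?andbF ?andbT.
    apply: le_trans (YL h) _; rewrite [leRHS](bigID (fun y => Y y == h)) /= -[leLHS]addr0.
    rewrite lerD ?sumr_ge0 // le_eqVlt; apply/orP; left; apply/eqP/eq_bigl=> y.
    rewrite ffunE; have [->|_] := eqVneq y x; last by rewrite andbb.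
    by rewrite Yx eq_sym (negbTE hk) andbF.
  move/Ymin; rewrite (bigD1 x) //= [leqRHS](bigD1 x) //= ffunE eqxx Yx.
  rewrite [X in (_ <= _ + X)%N](eq_bigr (fun y => rank (Y y)));
    last by move=> y /negbTE yx; rewrite ffunE yx.
  rewrite leq_add2r => le; have /eqP := jk; apply; apply: rinj; apply/eqP.
  by rewrite eqn_leq early.
have late x : tie x -> exists2 j, j \in N x & (rank k < rank j)%N.
  move=> tx; have := noex x; rewrite /= tx /= => /negbT.
  by rewrite negb_forall_in => /exists_inP[j jN]; rewrite -ltnNge; exists j.
have [g tg|notie] := pickP tie; last first.
  left; apply: strict => x Yx; have := notie x; rewrite /tie Yx /= => /negbFE/eqP//.
right; exists g; first by case/andP: tg => /eqP.
apply: strict => x /andP[Yx xg]; apply/eqP; apply: contraNT xg => Nx.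
have tx : tie x by rewrite /tie Yx.
have [j jN rj] := late _ tx; have [j' jN' rj'] := late _ tg.
apply/eqP; apply: (rP k x g j j') => //; last by case/andP: tg => /eqP<-.
by rewrite -(eqP Yx).
Qed.

End Rounding.

(** * Swapping bundles *)

Section Swaps.
Variables (R : realFieldType) (A M : finType).

Definition single_or_2ef (d : A -> M -> R) (f : M -> A) :=
  forall k, (#|[pred x | f x == k]| <= 1)%N \/
    forall j, \sum_(x | f x == k) d k x <= 2 * \sum_(x | f x == j) d k x.

(** An agent paying at most [2 * L] is content, as every bundle costs it at least [L]. Any other
    agent [u] owes its excess to one chore [g u]. Invariant [st]: everybody holds at most one chore,
    or is content and stays so when some bundle shrinks to [g u] alone with [u] still waiting, or
    waits with its original bundle. *)
Lemma swaps (d : A -> M -> R) (p : M -> R) (L : R) (Y : M -> A) :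
  (forall x, 0 <= p x) -> (forall i x, p x <= d i x) -> (forall x, d (Y x) x = p x) ->
  (forall k, L <= \sum_(x | Y x == k) p x) ->
  (forall k, \sum_(x | Y x == k) p x <= L \/
      exists2 g, Y g = k & \sum_(x | (Y x == k) && (x != g)) p x <= L) ->
  exists f, single_or_2ef d f.
Proof.
move=> p0 pd dY YL Ygood.
have d0 i x : 0 <= d i x by apply: le_trans (pd i x).
have [x0 _|M0] := pickP (@predT M); last first.
  by exists Y => k; left; rewrite (@eq_card0 _ [pred x | Y x == k]) // => x; have := M0 x.
pose load k (X : M -> A) j := \sum_(x | X x == j) d k x.
have load0 k X j : 0 <= load k X j by apply: sumr_ge0.
have loadY k : load k Y k = \sum_(x | Y x == k) p x.
  by apply: eq_bigr => x /eqP <-.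
have Lload X k j : L <= \sum_(x | X x == j) p x -> L <= load k X j.
  by move/le_trans; apply; apply: ler_sum.
have [g gP] : exists g : A -> M, forall k, 2 * L < load k Y k ->
    [/\ Y (g k) = k, L < p (g k) & load k Y k <= p (g k) + L].
  apply: (@fin_all_exists _ _ (fun k g => 2 * L < load k Y k ->
    [/\ Y g = k, L < p g & load k Y k <= p g + L])) => k.
  have [le|[g gk le]] := Ygood k; last first.
    exists g; rewrite loadY (bigD1 g) ?gk //= => gt.
    by split => //; lra.
  have := YL k; rewrite -loadY => ge; exists x0; rewrite loadY.
  have L0 : 0 <= L by apply: le_trans le; apply: sumr_ge0.
  by move=> gt; exfalso; lra.
(* [U] is the set of agents still to be processed. *)
pose st (U : {set A}) (X : M -> A) :=
  [/\ {in U, forall u, 2 * L < load u Y u},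
      forall h, L <= \sum_(x | X x == h) p x &
      forall k, [\/ (#|[pred x | X x == k]| <= 1)%N,
        (forall j, load k X k <= 2 * load k X j) /\
        {in U, forall u, load k X k <= 2 * d k (g u)} |
        k \in U /\ forall x, (X x == k) = (Y x == k)]].
suff H m (U : {set A}) X : (#|U| <= m)%N -> st U X -> exists f, single_or_2ef d f.
  apply: (H #|A| [set u | 2 * L < load u Y u] Y (max_card _)); split=> //.
    by move=> u; rewrite inE.
  move=> k; have [le|gt] := leP (load k Y k) (2 * L); last by constructor 3; rewrite inE.
  constructor 2; split=> [j|u]; first by apply: le_trans le _; rewrite ler_pM2l // Lload.
  rewrite inE => /gP[_ gu _]; apply: le_trans le _; rewrite ler_pM2l //.
  by apply: le_trans (pd _ _); apply: ltW.
elim: m U X => [|m IH] U X leU [UL XL Xst].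
  exists X => k; have [?|[? _]|[kU _]] := Xst k; [by left|by right|].
  by move: leU; rewrite leqn0 cards_eq0 => /eqP U0; rewrite U0 inE in kU.
have [i0 i0U|U0] := pickP (mem U); last first.
  by apply: (IH U X) => //; rewrite eq_card0.
have [i iU imin] : exists2 i, i \in U & {in U, forall u, p (g i) <= p (g u)}.
  pose i := [arg min_(i < i0 | i \in U) p (g i)]%O.
  by exists i; rewrite /i; case: arg_minP.
have [gi gL gle] := gP i (UL i iU).
have leU' : (#|U :\ i| <= m)%N by rewrite (cardsD1 i U) iU in leU.
have UL' : {in U :\ i, forall u, 2 * L < load u Y u} by move=> u /setD1P[_ /UL].
have keep : (forall x, (X x == i) = (Y x == i)) -> load i X i = load i Y i.
  by move=> h; apply: eq_bigl.
have skip : (#|[pred x | X x == i]| <= 1)%N \/ (forall j, load i X i <= 2 * load i X j) /\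
        {in U, forall u, load i X i <= 2 * d i (g u)} -> exists f, single_or_2ef d f.
  move=> hi; apply: (IH (U :\ i) X leU'); split=> // k.
  have [->|ki] := eqVneq k i.
    case: hi => [h|[h1 h2]]; first by constructor 1.
    by constructor 2; split=> // u /setD1P[_]; apply: h2.
  have [h|[h1 h2]|[kU h]] := Xst k; first by constructor 1.
    by constructor 2; split=> // u /setD1P[_]; apply: h2.
  by constructor 3; rewrite !inE ki.
have [h|h|[_ XY]] := Xst i; [by apply: skip; left|by apply: skip; right|].
have Xgi : X (g i) = i by apply/eqP; rewrite XY gi.
have dgi : d i (g i) = p (g i) by have := dY (g i); rewrite gi.
(* If [i] is content it may retire: its load is at most [p (g i) + L], hence below [2 * p (g i)],
   and by the choice of [i] at most twice the price of any waiting [g u]. *)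
have [/forallP ef|] := boolP [forall j, load i X i <= 2 * load i X j].
  apply: skip; right; split=> // u uU; rewrite keep //.
  by have := imin u uU; have := pd i (g u); lra.
rewrite negb_forall => /existsP[j0]; rewrite -ltNge => j0lt.
have j0i : j0 != i by apply: contraTneq j0lt => ->; rewrite -leNgt; have := load0 i X i; lra.
pose j := [arg min_(j < j0 | j != i) load i X j]%O.
have [ji jmin] : j != i /\ forall h, h != i -> load i X j <= load i X h.
  by rewrite /j; case: arg_minP.
have jlt : 2 * load i X j < load i X i by have := jmin _ j0i; lra.
pose X' x := if x == g i then j else if X x == j then i else X x.
have X'j x : (X' x == j) = (x == g i).
  rewrite /X'; case: (x =P g i) => _; first exact: eqxx.
  by have [_|/negbTE->//] := eqVneq (X x) j; rewrite eq_sym (negbTE ji).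
have X'h h x : h != i -> h != j -> (X' x == h) = (X x == h).
  move=> hi hj; rewrite /X'; have [->|_] := eqVneq x (g i).
    by rewrite Xgi ![_ == h]eq_sym (negbTE hi) (negbTE hj).
  by have [->|//] := eqVneq (X x) j; rewrite ![_ == h]eq_sym (negbTE hi) (negbTE hj).
have X'i x : (X' x == i) = (X x == j) || (X x == i) && (x != g i).
  rewrite /X'; have [->|_] := eqVneq x (g i).
    by rewrite Xgi (negbTE ji) eq_sym (negbTE ji) eqxx.
  by have [_|_] := eqVneq (X x) j; rewrite ?eqxx ?andbT.
have sumj (F : M -> R) : \sum_(x | X' x == j) F x = F (g i).
  by rewrite (eq_bigl (pred1 (g i))) ?big_pred1_eq // => x; rewrite X'j.
have sumi (F : M -> R) : \sum_(x | X' x == i) F x =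
    \sum_(x | X x == j) F x + \sum_(x | (X x == i) && (x != g i)) F x.
  rewrite (eq_bigl _ _ X'i) (bigID (fun x => X x == j)) /=; congr (_ + _); apply: eq_bigl => x.
    by case: (X x == j); rewrite ?andbF.
  by have [->|] := eqVneq (X x) j; rewrite ?andbF ?andbT //= (negbTE ji).
have sumh (F : M -> R) h : h != i -> h != j ->
    \sum_(x | X' x == h) F x = \sum_(x | X x == h) F x.
  by move=> hi hj; apply: eq_bigl => x; rewrite X'h.
have load_i : load i X' i = load i X j + (load i X i - p (g i)).
  have -> : load i X i = p (g i) + \sum_(x | (X x == i) && (x != g i)) d i x.
    by rewrite /load (bigD1 (g i)) /= ?Xgi // dgi.
  by rewrite [load i X' i]sumi /load; ring.
have keepi := keep XY.
apply: (IH (U :\ i) X' leU'); split=> //.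
  move=> h; have [->|hi] := eqVneq h i.
    by rewrite sumi; apply: le_trans (XL j) _; rewrite lerDl sumr_ge0.
  have [->|hj] := eqVneq h j; first by rewrite sumj ltW.
  by rewrite sumh.
move=> k; have [->|kj] := eqVneq k j.
  by constructor 1; rewrite (eq_card X'j) card1.
have [->|ki] := eqVneq k i.
  (* The new load of [i] is at most [load i X j + L], and neither term exceeds what any third bundle
     costs [i]. Against [j], both terms are below [p (g i)]. *)
  constructor 2; split=> [h|u /setD1P[_ uU]]; last first.
    by have := imin u uU; have := pd i (g u); lra.
  have [->|hi] := eqVneq h i; first by have := load0 i X' i; lra.
  have [->|hj] := eqVneq h j; first by rewrite {2}/load sumj; lra.
  rewrite {2}/load sumh // -/(load i X h); have := jmin h hi.
  by have := Lload X i h (XL h); lra.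
have [le|[h1 h2]|[kU h]] := Xst k.
- by constructor 1; rewrite (eq_card (B := [pred x | X x == k])) // => x; rewrite !inE X'h.
(* For a content [k], the new bundle of [i] contains the old one of [j], and the new bundle of [j]
   is covered by the invariant for [g i]. *)
- constructor 2; rewrite [load k X' k]sumh //; split=> [h|u /setD1P[_ /h2]//].
  have [->|hi] := eqVneq h i.
    rewrite [load k X' i]sumi; apply: le_trans (h1 j) _; rewrite ler_pM2l // lerDl.
    by apply: sumr_ge0.
  have [->|hj] := eqVneq h j; first by rewrite [load k X' j]sumj h2.
  by rewrite [load k X' h]sumh //; apply: h1.
by constructor 3; rewrite !inE ki kU; split=> // x; rewrite X'h.
Qed.

End Swaps.

(** * Generic costs *)

Section Acyclic.
Variables (R : realFieldType) (A M : finType).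

(** A walk that never leaves an agent through the chore it arrived by must revisit an agent; cutting
    at the first revisit leaves a simple cycle. Chore [z n.+1] links [a n] to [a n.+1]. *)
Lemma walk_cycle (C : {set A}) (N : M -> {set A}) : C != set0 ->
  (forall c, c \in C -> forall z, exists y c',
     [/\ y != z, c \in N y, c' \in N y, c' \in C & c' != c]) -> M ->
  exists (a : nat -> A) (z : nat -> M) (t : nat),
    [/\ forall n, [/\ z n.+2 != z n.+1, a n \in N (z n.+1), a n.+1 \in N (z n.+1)
                  & a n.+1 != a n],
        a t = a 0%N, (0 < t)%N & forall m n, (m < t)%N -> (n < t)%N -> a m = a n -> m = n].
Proof.
move=> /set0Pn[c0 c0C] step z0.
have [next nextP] : exists next : A * M -> M * A, forall s, s.1 \in C ->
    [/\ (next s).1 != s.2, s.1 \in N (next s).1, (next s).2 \in N (next s).1,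
        (next s).2 \in C & (next s).2 != s.1].
  apply: (@fin_all_exists _ _ (fun s (q : M * A) => s.1 \in C ->
    [/\ q.1 != s.2, s.1 \in N q.1, q.2 \in N q.1, q.2 \in C & q.2 != s.1])) => -[c z] /=.
  have [/step/(_ z)[y [c' h]]|cC] := boolP (c \in C); first by exists (y, c').
  by exists (z, c); rewrite /= (negbTE cC).
pose s n := iter n (fun s => let q := next s in (q.2, q.1)) (c0, z0).
have sC n : (s n).1 \in C.
  by elim: n => [//|n IH]; rewrite /s iterS -/(s n) /=; case: (nextP _ IH).
have sP n := nextP _ (sC n).
have rep : exists t, [exists m : 'I_t, (s m).1 == (s t).1].
  have /injectivePn[i [j ij E]] : ~~ injectiveb (fun i : 'I_#|A|.+1 => (s i).1).
    by apply/injectiveP => /leq_card; rewrite card_ord ltnn.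
  have [lt|gt|/val_inj/eqP] := ltngtP i j; last by rewrite (negbTE ij).
    by exists j; apply/existsP; exists (Ordinal lt); rewrite /= E.
  by exists i; apply/existsP; exists (Ordinal gt); rewrite /= E.
case: (ex_minnP rep) => t /existsP[m /eqP st] tmin.
exists (fun n => (s (m + n)%N).1), (fun n => (s (m + n)%N).2), (t - m)%N; split.
- move=> n; rewrite !addnS; have [_ h2 h3 _ h5] := sP (m + n)%N.
  by split; [have [] := sP (m + n).+1 | exact: h2 | exact: h3 | exact: h5].
- by rewrite addn0 subnKC ?st // ltnW.
- by rewrite subn_gt0.
have aux i j : (i < j)%N -> (j < t)%N -> (s i).1 = (s j).1 -> False.
  move=> ij jt E; suff : (t <= j)%N by rewrite leqNgt jt.
  by apply: tmin; apply/existsP; exists (Ordinal ij); rewrite /= E.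
move=> i j it jt E; have [lt|gt|//] := ltngtP i j; exfalso.
  by apply: (aux (m + i)%N (m + j)%N) => //; lia.
by apply: (aux (m + j)%N (m + i)%N) => //; lia.
Qed.

(** Otherwise there is a cycle of ties. Multiplying its equations cancels all weights and leaves two
    equal products of costs, over [S] and [S'], which genericity forbids. *)
Lemma generic_acyclic (c : A * M -> R) (v : A -> R) (N : M -> {set A}) :
  (forall s, 0 < c s) -> (forall i, 0 < v i) ->
  (forall S S' : {set A * M}, \prod_(s in S) c s = \prod_(s in S') c s -> S = S') ->
  (forall x i j, i \in N x -> j \in N x -> c (i, x) * v j = c (j, x) * v i) ->
  forall C : {set A}, C != set0 -> exists2 k, k \in C &
     forall x y j j', k \in N x -> k \in N y -> j \in N x :&: C ->
       j' \in N y :&: C -> j != k -> j' != k -> x = y.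
Proof.
move=> c0 v0 gen tie C C0; apply: contrapT => no.
have step k : k \in C -> forall z, exists y k',
     [/\ y != z, k \in N y, k' \in N y, k' \in C & k' != k].
  move=> kC z; apply: contrapT => nz; apply: no; exists k => // x y j j' kx ky.
  rewrite !inE => /andP[jx jC] /andP[jy j'C] jk j'k.
  have [xz|xz] := eqVneq x z; last by case: nz; exists x, j.
  have [yz|yz] := eqVneq y z; last by case: nz; exists y, j'.
  by rewrite xz yz.
have [z0 _] : exists z0 : M, true.
  have /set0Pn[k kC] := C0; apply: contrapT => nM.
  by apply: no; exists k => // x; case: nM; exists x.
have [a [z [t [walk at0 t0 ainj]]]] := walk_cycle C0 step z0.
case: t t0 at0 ainj => // t _ at0 ainj.
have t1 : (0 < t)%N.
  by case: t at0 {ainj} => // a1; have [_ _ _] := walk 0%N; rewrite a1 eqxx.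
pose S := [set (a u, z u.+1) | u : 'I_t.+1]; pose S' := [set (a u.+1, z u.+1) | u : 'I_t.+1].
have injS : injective (fun u : 'I_t.+1 => (a u, z u.+1)).
  by move=> i j [E _]; apply: val_inj; apply: (ainj i j) => //; apply: ltn_ord.
have injS' : injective (fun u : 'I_t.+1 => (a u.+1, z u.+1)).
  pose nx i := if i == t then 0%N else i.+1.
  have nxP (i : nat) : a i.+1 = a (nx i) by rewrite /nx; case: eqP => [->|].
  have nxt (i : 'I_t.+1) : (nx i < t.+1)%N.
    by have := ltn_ord i; rewrite /nx; case: eqP => // it; rewrite ltnS leq_eqVlt => /predU1P[].
  move=> i j [E _]; apply/val_inj => /=; move: E; rewrite !nxP => /ainj-/(_ (nxt i) (nxt j)).
  by rewrite /nx; case: eqP => [->|_]; case: eqP => [->|_] // [].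
have prodv : \prod_(u < t.+1) v (a u.+1) = \prod_(u < t.+1) v (a u).
  by rewrite big_ord_recr big_ord_recl /= at0 mulrC.
have : S = S'.
  apply: gen; rewrite !big_imset /=; [|exact: in2W injS'|exact: in2W injS].
  have v0' : \prod_(u < t.+1) v (a u) != 0 by apply/prodf_neq0 => u _; rewrite gt_eqF.
  apply: (mulIf v0'); rewrite -{1}prodv -!big_split; apply: eq_bigr => u _ /=.
  by have [_ k1 k2 _] := walk u; apply: tie.
(* This pair lies in [S]. In [S'], the agent [a 1] is paired only with [z 1], which differs from
   [z 2]. *)
move/setP/(_ (a 1%N, z 2%N)).
have -> : (a 1%N, z 2%N) \in S.
  by apply/imsetP; exists (Ordinal (t1 : (1 < t.+1)%N)).
case/esym/imsetP=> u _ [E1 E2].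
have := ltn_ord u; rewrite ltnS leq_eqVlt => /predU1P[ut|ut].
  by move: E1; rewrite ut at0; have [_ _ _ /eqP] := walk 0%N.
have [u0] : 1%N = u.+1 by apply: ainj.
by have [/eqP] := walk 0%N; rewrite E2 -u0.
Qed.

End Acyclic.

Section Perturbation.

Lemma binary_digits_inj n (b b' : nat -> bool) :
  (\sum_(i < n) b i * 2 ^ i = \sum_(i < n) b' i * 2 ^ i)%N ->
  forall i, (i < n)%N -> b i = b' i.
Proof.
elim: n b b' => // n IH b b'; rewrite !big_ord_recl /= !expn0 !muln1.
have shift (f : nat -> bool) : (\sum_(i < n) f (bump 0 i) * 2 ^ bump 0 i =
    (\sum_(i < n) f i.+1 * 2 ^ i).*2)%N.
  by rewrite -mul2n big_distrr; apply: eq_bigr => i _; rewrite /bump add1n expnS mulnCA.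
rewrite !shift => E; have b0 : b 0%N = b' 0%N by case: (b 0%N) (b' 0%N) E => -[]; lia.
move=> [//|i]; apply: (IH (fun i => b i.+1) (fun i => b' i.+1)).
by move: E; rewrite b0; lia.
Qed.

Lemma subset_weights_inj (P : finType) (S S' : {set P}) :
  (\sum_(a in S) 2 ^ enum_rank a = \sum_(a in S') 2 ^ enum_rank a)%N -> S = S'.
Proof.
case: (pickP (@predT P)) => [a0 _|P0]; last by move=> _; apply/setP => a; have := P0 a.
have E (S0 : {set P}) : (\sum_(a in S0) 2 ^ enum_rank a =
    \sum_(i < #|P|) (nth a0 (enum P) i \in S0) * 2 ^ i)%N.
  rewrite (reindex (@enum_val P P)) /=; last by apply: onW_bij; apply: enum_val_bij.
  rewrite big_mkcond; apply: eq_bigr => i _.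
  rewrite enum_valK -(enum_val_nth a0).
  by case: ifP; rewrite ?mul1n.
rewrite !E => /(@binary_digits_inj _ (fun i => nth a0 (enum P) i \in S)
  (fun i => nth a0 (enum P) i \in S')) H.
by apply/setP=> a; have := H _ (ltn_ord (enum_rank a)); rewrite -enum_val_nth enum_rankK.
Qed.

(** Add [h ^+ w a] to the cost of [a], with distinct powers of two as exponents. Products over
    subsets are monic polynomials in [h] of pairwise distinct degrees, so a small [h] avoiding
    finitely many roots separates them all. *)
Lemma generic_perturbation (R : realFieldType) (P : finType) (c : P -> R) (e : R) :
  (forall a, 0 <= c a) -> 0 < e ->
  exists c' : P -> R, [/\ forall a, 0 < c' a, forall a, c a <= c' a <= c a + e &
    forall S S' : {set P}, \prod_(a in S) c' a = \prod_(a in S') c' a -> S = S'].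
Proof.
move=> c0 e0.
pose w (a : P) := (2 ^ enum_rank a)%N.
have w0 a : (0 < w a)%N by rewrite expn_gt0.
pose q a : {poly R} := 'X^(w a) + (c a)%:P.
have sq a : size (q a) = (w a).+1.
  by rewrite size_polyDl size_polyXn // ltnS (leq_trans (size_polyC_leq1 _)).
have mq a : q a \is monic.
  by rewrite monicE lead_coefDl ?lead_coefXn // size_polyXn ltnS (leq_trans (size_polyC_leq1 _)).
have sprod (S : {set P}) : size (\prod_(a in S) q a) = (\sum_(a in S) w a).+1.
  rewrite size_prod => [|a _]; last by rewrite monic_neq0.
  rewrite (eq_bigr (fun a => w a + 1)%N) => [|a _]; last by rewrite sq addn1.
  by rewrite big_split /= sum1_card -addSn addnK.
pose D (s : {set P} * {set P}) := \prod_(a in s.1) q a - \prod_(a in s.2) q a.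
have D0 s : s.1 != s.2 -> D s != 0.
  apply: contraNneq => /eqP; rewrite subr_eq0 => /eqP/(congr1 (size \o polyseq)) /=.
  by rewrite !sprod => -[] /subset_weights_inj ->.
pose Q := \prod_(s | s.1 != s.2) D s.
have Q0 : Q != 0 by apply/prodf_neq0 => s /D0.
have [n0 n1] : 0 < Num.min 1 e /\ Num.min 1 e <= 1 by rewrite lt_min ltr01 e0 ge_min lexx.
have [h [h0 h1 hQ]] : exists h, [/\ 0 < h, h <= Num.min 1 e & ~~ root Q h].
  pose rs := [seq Num.min 1 e / k.+1%:R | k <- iota 0 (size Q)].
  have /allPn[h] : ~~ all (root Q) rs.
    apply/negP => /(max_poly_roots Q0); rewrite size_map size_iota ltnn => H.
    suff: false by []; apply: H; rewrite map_inj_uniq ?iota_uniq // => i j.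
    move/(mulfI (lt0r_neq0 n0))/invr_inj/eqP; rewrite eqr_nat => /eqP[].
    by [].
  case/mapP=> k _ -> nr; exists (Num.min 1 e / k.+1%:R); split=> //.
    by rewrite divr_gt0.
  by rewrite ler_pdivrMr // ler_peMr ?ler1n // ltW.
have hw a : 0 < h ^+ w a /\ h ^+ w a <= e.
  rewrite exprn_gt0 //; split=> //; have h11 : h <= 1 by apply: le_trans n1.
  have he : h <= e by apply: le_trans h1 _; rewrite ge_min lexx orbT.
  by apply: le_trans he; rewrite -(prednK (w0 a)) exprS ger_pMr // exprn_ile1 // ltW.
exists (fun a => (q a).[h]); split.
- by move=> a; rewrite !hornerE; have [] := hw a; have := c0 a; lra.
- by move=> a; rewrite !hornerE; have [] := hw a; lra.
move=> S S' E; apply/eqP; apply: contraNT hQ => SS'.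
rewrite /Q (bigD1 (S, S')) //= rootM; apply/orP; left.
by rewrite /root /D hornerD hornerN !horner_prod /= E subrr.
Qed.

End Perturbation.

(** * Balanced weights *)

Section LinearSystems.
Local Open Scope classical_set_scope.
Local Open Scope ring_scope.

(** Compactness: the total violation [F] attains its minimum on the unit cube, and approximate
    solutions make that minimum arbitrarily small. *)
Lemma weight_system_limit (R : realType) (A J : finType)
    (al be : J -> R) (p q : J -> A) :
  (forall e, 0 < e -> exists v : A -> R, [/\ forall i, 0 <= v i, \sum_i v i = 1
     & forall j, al j * v (p j) - be j * v (q j) <= e]) ->
  exists v : A -> R, [/\ forall i, 0 <= v i, \sum_i v i = 1
     & forall j, al j * v (p j) - be j * v (q j) <= 0].
Proof.
move=> approx.
pose l j (v : 'rV[R]_#|A|) := al j * v ord0 (enum_rank (p j)) - be j * v ord0 (enum_rank (q j)).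
pose s (v : 'rV[R]_#|A|) := \sum_(i : A) v ord0 (enum_rank i).
(* Each summand is twice the positive part of [l j], so satisfied constraints contribute nothing. *)
pose F v := \sum_j (`|l j v| + l j v) + `|s v - 1|.
pose B := [set v : 'rV[R]_#|A| | forall i, v ord0 i \in `[0, 1]].
have sum_cont (I : finType) (f : I -> 'rV[R]_#|A| -> R) :
    (forall i, continuous (f i)) -> continuous (fun v => \sum_i f i v).
  move=> fc; apply: continuous_big => // z.
  by apply: cvgD; [exact: cvg_fst | exact: cvg_snd].
have coordZ_cont (b : R) (i : A) :
    continuous (fun v : 'rV[R]_#|A| => b * v ord0 (enum_rank i)).
  move=> v; apply: (@continuous_comp _ _ _ _ ( *%R b) v).
    exact: coord_continuous.
  exact: mulrl_continuous.
have l_cont j : continuous (l j).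
  move=> v; apply: (@continuousB _ _ _
    (fun v : 'rV[R]_#|A| => al j * v ord0 (enum_rank (p j)))
    (fun v : 'rV[R]_#|A| => be j * v ord0 (enum_rank (q j))) v); exact: coordZ_cont.
have s_cont : continuous s by apply: sum_cont => i; exact: coord_continuous.
have F_cont : continuous F.
  have abs_cont (f : 'rV[R]_#|A| -> R) : continuous f -> continuous (fun v => `|f v|).
    move=> fc v; apply: (@continuous_comp _ _ _ f Num.norm v); first exact: fc.
    exact: (@norm_continuous R R^o).
  move=> v; apply: (@continuousD _ _ _ (fun v => \sum_j (`|l j v| + l j v))
      (fun v => `|s v - 1|) v).
    apply: sum_cont => j u; apply: (@continuousD _ _ _ (fun v => `|l j v|) (l j) u).
      exact: abs_cont.
    exact: l_cont.
  apply: (abs_cont (fun v => s v - 1)) => u.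
  by apply: (@continuousB _ _ _ s (fun=> 1) u); [exact: s_cont | exact: cst_continuous].
have B_compact : compact B.
  by apply: (@rV_compact _ _ (fun=> `[0 : R, 1 : R]%classic)) => i; exact: segment_compact.
have B0 : B !=set0.
  by exists 0 => i /=; rewrite mxE in_itv /= lexx ler01.
have [v] := compact_EVT_min B0 B_compact (continuous_subspaceT F_cont).
rewrite classical_sets.inE => vB vmin.
have term0 j u : 0 <= `|l j u| + l j u by have := ler_norm (- l j u); rewrite normrN; lra.
have F0 : F v <= 0.
  rewrite leNgt; apply/negP => F0.
  set e := F v / (2 * #|J|.+1%:R).
  have e0 : 0 < e by rewrite divr_gt0 // mulr_gt0 // ltr0n.
  have eF : \sum_(j : J) 2 * e < F v.
    have -> : F v = 2 * e + #|J|%:R * (2 * e).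
      have N0 : #|J|.+1%:R != 0 :> R by rewrite pnatr_eq0.
      rewrite -[X in X + _]mul1r -mulrDl nat1r /e.
      by move: (#|J|.+1%:R) N0 => N N0; field.
    by rewrite sumr_const -[X in X < _]mulr_natl ltrDr mulr_gt0.
  have [u [u0 u1 ule]] := approx e e0.
  pose w : 'rV[R]_#|A| := \row_i u (enum_val i).
  have wE i : w ord0 (enum_rank i) = u i by rewrite mxE enum_rankK.
  have wB : B w.
    move=> i /=; rewrite in_itv /= mxE u0 /= -u1 (bigD1 (enum_val i)) //= lerDl.
    exact: sumr_ge0.
  have := vmin w; rewrite classical_sets.inE => /(_ wB).
  have lw j : l j w <= e by rewrite /l !wE.
  have sw : s w = 1 by rewrite -u1; apply: eq_bigr => i _; rewrite wE.
  rewrite [F w]/F sw subrr normr0 addr0 leNgt => /negP; apply.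
  apply: (@le_lt_trans _ _ (\sum_(j : J) 2 * e)).
    apply: ler_sum => j _; have := lw j; have [?|?] := leP 0 (l j w).
      by rewrite ger0_norm //; lra.
    by rewrite ltr0_norm // addNr => _; lra.
  exact: eF.
have [sum0 s0] : \sum_j (`|l j v| + l j v) <= 0 /\ `|s v - 1| <= 0.
  have : 0 <= \sum_j (`|l j v| + l j v) by apply: sumr_ge0.
  have : 0 <= `|s v - 1| by [].
  by move: F0; rewrite /F; lra.
exists (fun i => v ord0 (enum_rank i)); split.
- by move=> i; have := vB (enum_rank i); rewrite /= in_itv /= => /andP[].
- by move: s0; rewrite normr_le0 subr_eq0 => /eqP.
move=> j; rewrite -[leLHS]/(l j v); have : `|l j v| + l j v <= 0.
  by apply: le_trans sum0; rewrite (bigD1 j) //= lerDl sumr_ge0.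
by have := normr_ge0 (l j v); lra.
Qed.

End LinearSystems.

Section Grid.
Local Open Scope nat_scope.
Variables (A : finType) (i0 : A).

(** Scarf's lemma on the integer points of the simplex of size [N], ordered by coordinates.
    Dominance keeps [D] close together. The bound on labels replaces a boundary condition: it forces
    [C] to contain every label. *)
Lemma close_labels (N K : nat) (col : (A -> nat) -> A) :
  (forall z i, (z (col z)).+1 <= K * (z i).+1) ->
  #|A| * (K * #|A|.+1) <= N ->
  exists d : A -> A -> nat, forall k,
    [/\ col (d k) = k, \sum_i d k i = N & forall k' i, d k i <= d k' i + #|A|].
Proof.
move=> colP leN.
pose in_grid (z : {ffun A -> 'I_N.+1}) := \sum_i z i == N.
pose T : finType := {z | in_grid z}.
pose val_of (t : T) (i : A) : nat := sval t i.
have ofS (y : A -> nat) : \sum_i y i = N -> exists t : T, forall i, val_of t i = y i.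
  move=> sy; have yN i : y i < N.+1 by rewrite ltnS -sy (bigD1 i) //= leq_addr.
  have st : in_grid [ffun i => Ordinal (yN i)].
    by rewrite /in_grid -[X in _ == X]sy; apply/eqP/eq_bigr => i _; rewrite ffunE.
  by exists (exist in_grid _ st) => i; rewrite /val_of /= ffunE.
have [t0 _] : exists t : T, forall i, val_of t i = if i == i0 then N else 0.
  apply: ofS; rewrite (bigD1 i0) //= eqxx big1 ?addn0 // => i /negbTE->//.
pose r i t := val_of t i * #|T| + enum_rank t.
have r_inj i : injective (r i).
  move=> t u /(congr1 (modn ^~ #|T|)); rewrite !modnMDl !modn_small //.
  by move/val_inj/enum_rank_inj.
have rle i t u : r i t <= r i u -> val_of t i <= val_of u i.
  have := ltn_ord (enum_rank u); rewrite /r; set w := #|_|; nia.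
have [D [C [C0 dom colD]]] := scarf (fun t => col (val_of t)) r_inj t0 i0.
have [i1 i1C] := set0Pn _ C0.
have colC k : k \in C -> exists2 t, t \in D & col (val_of t) = k.
  by move/(subsetP colD)/imsetP => [t tD ->]; exists t.
have [t1 t1D _] := colC i1 i1C.
pose m i := val_of [arg min_(t < t1 | t \in D) val_of t i] i.
have mmin i t : t \in D -> m i <= val_of t i.
  by rewrite /m; case: arg_minnP => // u _ h /h.
have mD i : exists2 t, t \in D & val_of t i = m i.
  by rewrite /m; case: arg_minnP => // u uD _; exists u.
have sumval t : \sum_i val_of t i = N by apply/eqP; apply: (svalP t).
(* Otherwise some grid point would exceed the minimum over [D] in every coordinate of [C], against
   dominance. *)
have big : N < \sum_(i in C) (m i).+1.
  rewrite ltnNge; apply/negP => small.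
  pose rest := N - \sum_(i in C) (m i).+1.
  have [t ty] : exists t : T, forall i, val_of t i =
      if i \in C then (m i).+1 + (if i == i1 then rest else 0) else 0.
    apply: ofS; rewrite -big_mkcond big_split /= [X in _ + X](bigD1 i1) //= eqxx.
    rewrite [X in _ + (_ + X)]big1 ?addn0 ?subnKC // => i /andP[_ /negbTE->] //.
  have [i iC /= h] := dom t; have [u uD um] := mD i.
  have := rle _ _ _ (h u uD); rewrite ty iC um; lia.
have leC : #|C| <= #|A| := max_card _.
have [c leCA bigm] : exists2 c, c <= #|A| & N < \sum_(i in C) m i + c.
  exists #|C| => //; apply: leq_trans big _.
  by rewrite (eq_bigr (fun i => m i + 1)) ?big_split ?sum1_card // => i _; rewrite addn1.
have inC t i : t \in D -> i \in C -> val_of t i <= m i + #|A|.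
  move=> tD iC; have := sumval t; rewrite (bigD1 i) //=.
  have : \sum_(j in C | j != i) m j <= \sum_(j | j != i) val_of t j.
    rewrite [leqRHS](bigID (mem C)) /=; apply: leq_trans (leq_addr _ _).
    rewrite [leqRHS](eq_bigl (fun j => (j \in C) && (j != i))); last by move=> j; rewrite andbC.
    by apply: leq_sum => j _; apply: mmin.
  move: bigm; rewrite (bigD1 i) //=.
  move: leCA; move: (\sum_(j in C | _) _) (\sum_(j | j != i) _) #|A| (m i) (val_of t i).
  by clear; lia.
have outC t i : t \in D -> i \notin C -> val_of t i <= #|A|.
  move=> tD iC; have := sumval t; rewrite (bigD1 i) //=.
  have : \sum_(j in C) m j <= \sum_(j | j != i) val_of t j.
    rewrite [leqRHS](bigID (mem C)) /=; apply: leq_trans (leq_addr _ _).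
    rewrite [leqRHS](eq_bigl (fun j => j \in C)) => [|j].
      by apply: leq_sum => j _; apply: mmin.
    by have [jC|] := boolP (j \in C); rewrite ?andbF // andbT; apply: contraNneq iC => <-.
  move: bigm leCA; move: (\sum_(j in C) _) (\sum_(j | j != i) _) #|A| (val_of t i).
  by clear; lia.
(* A label [i] outside [C] has small coordinates on [D]. By [colP] the minima [m k] for [k] in [C]
   are then small too, too small to satisfy [big]. *)
have CT i : i \in C.
  apply: contraT => iC; move: big; rewrite ltnNge => /negP; case.
  apply: leq_trans leN; apply: (@leq_trans (\sum_(k in C) K * #|A|.+1)).
    apply: leq_sum => k kC; have [t tD tk] := colC k kC.
    apply: (@leq_trans (val_of t k).+1); first by rewrite ltnS mmin.
    rewrite -{1}tk; apply: leq_trans (colP _ i) _.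
    by rewrite leq_mul2l ltnS outC // orbT.
  by rewrite sum_nat_const leq_mul2r leC orbT.
have [t tP] : exists t : A -> T, forall k, t k \in D /\ col (val_of (t k)) = k.
  apply: (@fin_all_exists _ _ (fun k t => t \in D /\ col (val_of t) = k)) => k.
  by have [t tD tk] := colC k (CT k); exists t.
exists (fun k => val_of (t k)) => k; have [tD tk] := tP k; split=> // k' i.
have [tD' _] := tP k'.
by apply: leq_trans (inC _ i tD (CT i)) _; rewrite leq_add2r mmin.
Qed.

End Grid.

Section BalancedWeights.
Variables (R : realType) (A M : finType) (c : A -> M -> R) (i0 : A).
Hypothesis c_gt0 : forall i x, 0 < c i x.

(** Ties among least earners are broken by the smallest [z]. An agent whose weight times [K] is
    below that of [k] takes no chore, earns nothing and would have been preferred to [k]. The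
    successor keeps the weights positive. *)
Lemma least_earner (K : nat) (z : A -> nat) (v := fun i => (z i).+1%:R : R) :
  (0 < K)%N -> (forall i j x, c i x <= K%:R * c j x) ->
  exists (f : {ffun M -> A}) (k : A),
    [/\ forall x j, v j * c (f x) x <= v (f x) * c j x,
        forall h, v h * \sum_(x | f x == k) c k x <= v k * \sum_(x | f x == h) c h x &
        forall i, ((z k).+1 <= K * (z i).+1)%N].
Proof.
move=> K0 cK.
have v0 i : 0 < v i by rewrite ltr0n.
pose f := [ffun x => [arg min_(i < i0) c i x / v i]%O].
have fP x j : v j * c (f x) x <= v (f x) * c j x.
  rewrite /f ffunE; case: arg_minP => // i _ /(_ j isT).
  by rewrite ler_pdivrMr // mulrAC ler_pdivlMr // mulrC [leRHS]mulrC.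
pose e h := (\sum_(x | f x == h) c h x) / v h.
have e0 h : 0 <= e h by apply: divr_ge0; [apply: sumr_ge0 => x _|]; apply: ltW.
pose k0 := [arg min_(h < i0) e h]%O.
have k0P h : e k0 <= e h by rewrite /k0; case: arg_minP => // ? _; apply.
have k00 : e k0 <= e k0 by [].
case: (arg_minnP z (k00 : [pred h | e h <= e k0] k0)) => k /= ke kz.
have kP h : e k <= e h by apply: le_trans ke _.
exists f, k; split=> // [h|i].
  by have := kP h; rewrite ler_pdivrMr // mulrAC ler_pdivlMr // mulrC [leRHS]mulrC.
rewrite leqNgt; apply/negP => lt.
have noi x : (f x == i) = false.
  apply/negP => /eqP fx; have := fP x k; rewrite fx.
  have : v i * c k x <= v i * (K%:R * c i x) by rewrite ler_pM2l.
  move=> h1 h2; have := le_trans h2 h1; rewrite mulrA ler_pM2r // -natrM ler_nat mulnC.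
  by rewrite leqNgt lt.
have : (z k <= z i)%N by apply: kz; rewrite /= {1}/e (eq_bigl _ _ noi) big_pred0_eq mul0r e0.
by move: lt K0; nia.
Qed.

Lemma pos_lower_bound (J : finType) (e : J -> R) :
  (forall j, 0 < e j) -> exists2 d, 0 < d & forall j, d <= e j.
Proof.
move=> e0; have [j0 _|J0] := pickP (@predT J); last first.
  by exists 1 => // j; have := J0 j.
exists (e [arg min_(j < j0) e j]%O) => // j.
by case: arg_minP => // i _; apply.
Qed.

Lemma ratio_bound : exists2 K : nat, (0 < K)%N & forall i j x, c i x <= K%:R * c j x.
Proof.
pose r (s : A * A * M) := c s.1.1 s.2 / c s.1.2 s.2.
have r0 s : 0 <= r s by apply: divr_ge0; apply: ltW.
pose b := \sum_s r s.
have b0 : 0 <= b by apply: sumr_ge0.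
exists (Num.bound b).+1 => // i j x.
rewrite -ler_pdivrMr //; apply: (@le_trans _ _ b).
  by rewrite /b (bigD1 (i, j, x)) //= lerDl sumr_ge0.
by apply: le_trans (ltW (archi_boundP b0)) _; rewrite ler_nat.
Qed.

(** Label each grid point by its least earner. [close_labels] gives, for each [k], a point with
    label [k], all close together. The assignments at these points take finitely many values, so
    some fixed family of them admits approximate weights to every precision, and a limit gives exact
    ones. *)
Theorem balanced_weights : exists (v : A -> R) (X : A -> M -> A),
  [/\ forall i, 0 < v i,
      forall k x j, v j * c (X k x) x <= v (X k x) * c j x &
      forall k h, v h * \sum_(x | X k x == k) c k x <= v k * \sum_(x | X k x == h) c h x].
Proof.
have [K K0 cK] := ratio_bound.
have [own ownP] := choice (fun z => least_earner z K0 cK).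
have [col colP] := choice ownP.
pose Tup := {ffun A -> {ffun M -> A}}.
(* [J] lists the constraints: [t k x] attains the price of [x], [k] earns least under [t k], and
   [v k <= K * v i], which prevents zero weights. *)
pose J := (A * M * A + A * A + A * A)%type.
pose con (t : Tup) (j : J) : R * A * R * A :=
  match j with
  | inl (inl (k, x, j)) => (c (t k x) x, j, c j x, t k x)
  | inl (inr (k, h)) => (\sum_(x | t k x == k) c k x, h, \sum_(x | t k x == h) c h x, k)
  | inr (k, i) => (1, k, K%:R, i)
  end.
pose al t j := (con t j).1.1.1. pose p t j := (con t j).1.1.2.
pose be t j := (con t j).1.2. pose q t j := (con t j).2.
have ab0 t j : 0 <= al t j /\ 0 <= be t j.
  by case: j => [[[[k x] j]|[k h]]|[k i]]; rewrite /al /be /=; split=> //;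
    try (by apply: ltW); apply: sumr_ge0 => x _; apply: ltW.
pose exact_at t := exists v : A -> R, [/\ forall i, 0 <= v i, \sum_i v i = 1
     & forall j, al t j * v (p t j) - be t j * v (q t j) <= 0].
suff [t [v [v0 v1 vP]]] : exists t, exact_at t.
  exists v, (fun k => t k); split.
  - move=> i; rewrite lt0r v0 andbT; apply/negP => /eqP vi.
    have /eqP := v1; rewrite big1 ?(eq_sym 0) ?oner_eq0 // => k _; apply/eqP.
    by rewrite eq_le v0 andbT; have := vP (inr (k, i)); rewrite /al /be /= vi; lra.
  - by move=> k x j; have := vP (inl (inl (k, x, j))); rewrite /al /be /p /q /=; lra.
  - by move=> k h; have := vP (inl (inr (k, h))); rewrite /al /be /p /q /=; lra.
apply: contrapT => no_exact.
have [e eP] : exists e : Tup -> R, forall t, 0 < e t /\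
    ~ exists v : A -> R, [/\ forall i, 0 <= v i, \sum_i v i = 1
       & forall j, al t j * v (p t j) - be t j * v (q t j) <= e t].
  apply: (@fin_all_exists _ _ (fun t e => 0 < e /\
    ~ exists v : A -> R, [/\ forall i, 0 <= v i, \sum_i v i = 1
       & forall j, al t j * v (p t j) - be t j * v (q t j) <= e])) => t.
  apply: contrapT => no; apply: no_exact; exists t; apply: weight_system_limit => e e0.
  by apply: contrapT => ne; apply: no; exists e.
have [d d0 dP] := pos_lower_bound (fun t => (eP t).1).
pose B := \sum_t \sum_j (al t j + be t j).
have B0 : 0 <= B.
  by apply: sumr_ge0 => t _; apply: sumr_ge0 => j _; have [] := ab0 t j; lra.
have abB t j : al t j + be t j <= B.
  rewrite /B (bigD1 t) //= (bigD1 j) //= -addrA lerDl addr_ge0 //.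
    by apply: sumr_ge0 => j' _; have [] := ab0 t j'; lra.
  by apply: sumr_ge0 => t' _; apply: sumr_ge0 => j' _; have [] := ab0 t' j'; lra.
pose n := #|A|.
have n0 : (0 < n)%N by apply/card_gt0P; exists i0.
have Bd0 : 0 <= B * n%:R / d by rewrite !mulr_ge0 ?invr_ge0 // ltW.
(* The first summand is for [close_labels]; the second makes an error of [n] per coordinate, with
   coefficients bounded by [B], at most [d] after scaling. *)
pose N := (n * (K * n.+1) + Num.bound (B * n%:R / d))%N.
have colK z i : ((z (col z)).+1 <= K * (z i).+1)%N by have [] := colP z.
have [dd ddP] := close_labels i0 colK (leq_addr _ _ : (n * (K * n.+1) <= N)%N).
pose t : Tup := [ffun k => own (dd k)].
have [_ []] := eP t; pose s : R := N%:R + n%:R.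
have s0 : 0 < s by rewrite /s -natrD ltr0n addn_gt0 n0 orbT.
exists (fun i => (dd i0 i).+1%:R / s); split.
- by move=> i; rewrite divr_ge0 ?ler0n // ltW.
- rewrite -mulr_suml -[X in _ = X](@divff _ s) ?gt_eqF //; congr (_ / _).
  have [_ sdd _] := ddP i0.
  rewrite /s -sdd -natrD -natr_sum; congr (_%:R).
  by rewrite /n -sum1_card -big_split /=; apply: eq_bigr => i _; rewrite addn1.
move=> j.
have close k i : (dd i0 i).+1%:R <= (dd k i).+1%:R + n%:R :> R.
  by rewrite -natrD ler_nat addSn ltnS; have [_ _] := ddP i0; apply.
have close' k i : (dd k i).+1%:R <= (dd i0 i).+1%:R + n%:R :> R.
  by rewrite -natrD ler_nat addSn ltnS; have [_ _] := ddP k; apply.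
(* Each constraint involves the assignment of a single [k] and holds exactly at [dd k], hence
   approximately at [dd i0]. *)
have [k kP] : exists k, al t j * (dd k (p t j)).+1%:R - be t j * (dd k (q t j)).+1%:R <= 0.
  have P k := colP (dd k).
  case: j => [[[[k x] j]|[k h]]|[k i]]; exists k; rewrite /al /be /p /q /= ?ffunE;
    have [ek _ _] := ddP k; have [P1 P2 P3] := P k.
  - by rewrite subr_le0 mulrC [leRHS]mulrC P1.
  - by rewrite subr_le0 mulrC [leRHS]mulrC; have := P2 h; rewrite ek.
  - by rewrite subr_le0 mul1r -natrM ler_nat; have := P3 i; rewrite ek.
have [a0 b0] := ab0 t j.
apply: le_trans (dP t); rewrite !mulrA -mulrBl ler_pdivrMr //.
have h1 : al t j * (dd i0 (p t j)).+1%:R <= al t j * ((dd k (p t j)).+1%:R + n%:R).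
  by rewrite ler_wpM2l.
have h2 : be t j * (dd k (q t j)).+1%:R <= be t j * ((dd i0 (q t j)).+1%:R + n%:R).
  by rewrite ler_wpM2l.
have h3 : (al t j + be t j) * n%:R <= d * s.
  apply: (@le_trans _ _ (B * n%:R)); first by rewrite ler_wpM2r // abB.
  rewrite [leRHS]mulrC -ler_pdivrMr //; apply: le_trans (ltW (archi_boundP Bd0)) _.
  by rewrite /s -natrD ler_nat /N; lia.
by move: h1 h2 h3 kP; rewrite !mulrDr mulrDl; lra.
Qed.

End BalancedWeights.

(** * Fair assignments *)

Section Existence.
Variables (R : realType) (A M : finType) (i0 : A).

Lemma generic_single_or_2ef (c : A -> M -> R) :
  (forall i x, 0 < c i x) ->
  (forall S S' : {set A * M},
     \prod_(s in S) c s.1 s.2 = \prod_(s in S') c s.1 s.2 -> S = S') ->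
  exists f, single_or_2ef c f.
Proof.
move=> c0 gen; have [v [X [v0 Xmin Xleast]]] := balanced_weights i0 c0.
pose d i x := c i x / v i.
pose N x := [set i | [forall j, d i x <= d j x]].
have XN k x : X k x \in N x.
  rewrite inE; apply/forallP => j.
  by rewrite ler_pdivrMr // mulrAC ler_pdivlMr // mulrC [leRHS]mulrC.
pose p x := d (X i0 x) x.
have pd i x : p x <= d i x by have := XN i0 x; rewrite inE => /forallP.
have dN i x : i \in N x -> d i x = p x.
  by rewrite inE => /forallP iN; apply/eqP; rewrite eq_le iN pd.
have p0 x : 0 <= p x by rewrite divr_ge0 ?ltW.
have load k h : \sum_(x | X k x == h) p x = (\sum_(x | X k x == h) c h x) / v h.
  by rewrite mulr_suml; apply: eq_bigr => x /eqP <-; rewrite -(dN _ _ (XN k x)).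
have least k h : \sum_(x | X k x == k) p x <= \sum_(x | X k x == h) p x.
  by rewrite !load ler_pdivrMr // mulrAC ler_pdivlMr // mulrC [leRHS]mulrC.
pose k0 := [arg max_(k > i0) \sum_(x | X k x == k) p x]%O.
have k0P k : \sum_(x | X k x == k) p x <= \sum_(x | X k0 x == k0) p x.
  by rewrite /k0; case: arg_maxP => // ? _; apply.
have tie x i j : i \in N x -> j \in N x -> c i x * v j = c j x * v i.
  move=> iN jN; have := dN _ _ iN; rewrite -(dN _ _ jN) /d => /eqP.
  by rewrite (eqr_div _ _ (lt0r_neq0 (v0 i)) (lt0r_neq0 (v0 j))) => /eqP.
have [rank rinj rP] := elimination_rank (generic_acyclic (c := fun s => c s.1 s.2)
  (fun s => c0 s.1 s.2) v0 gen tie).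
(* A chore that only [k] can take is in its bundle under [X k], where [k] earns at most what [k0]
   earns under [X k0]; this last value is the [L] of the rounding. *)
have strict k : \sum_(x | N x == [set k]) p x <= \sum_(x | X k0 x == k0) p x.
  apply: le_trans (k0P k); rewrite [leRHS](bigID (fun x => N x == [set k])) /=.
  rewrite -[leLHS]addr0 lerD ?sumr_ge0 // le_eqVlt; apply/orP; left; apply/eqP/eq_bigl => x.
  by have := XN k x; have [->|_] := eqVneq (N x) [set k]; rewrite ?andbF // inE => ->.
have [Y [YN YL Ygood]] := rounding p0 (XN k0) (least k0) strict rinj rP.
have [f fP] := swaps p0 pd (fun x => dN _ _ (YN x)) YL Ygood.
exists f => k; have [?|h] := fP k; [by left|right=> j].
by have := h j; rewrite -!mulr_suml mulrA ler_pM2r ?invr_gt0.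
Qed.

(* Genericity is removed by a perturbation smaller than the least violation
   over the finitely many assignments. *)
Theorem exists_single_or_2ef (c : A -> M -> R) :
  (forall i x, 0 <= c i x) -> exists f, single_or_2ef c f.
Proof.
move=> c0; apply: contrapT => none.
have viol (f : {ffun M -> A}) : exists kj : A * A,
    (1 < #|[pred x | f x == kj.1]|)%N /\
    0 < \sum_(x | f x == kj.1) c kj.1 x - 2 * \sum_(x | f x == kj.2) c kj.1 x.
  apply: contrapT => no; apply: none; exists f => k.
  have [?|card] := leqP #|[pred x | f x == k]| 1; [by left|right=> j].
  rewrite leNgt; apply/negP => lt; apply: no; exists (k, j); split=> //=.
  by rewrite subr_gt0.
have [kj kjP] := fin_all_exists viol.
have [e e0 eP] := pos_lower_bound (fun f => (kjP f).2).
have M0 : 0 < 2 * #|M|.+1%:R :> R by rewrite mulr_gt0 // ltr0n.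
have := divr_gt0 e0 M0; set w := e / _ => w0.
have [c' [c'0 c'c gen]] := generic_perturbation (c := fun s : A * M => c s.1 s.2)
  (fun s => c0 s.1 s.2) w0.
have [||f fP] := @generic_single_or_2ef (fun i x => c' (i, x)).
- by move=> i x.
- have pairing (S : {set A * M}) : \prod_(s in S) c' (s.1, s.2) = \prod_(s in S) c' s.
    by apply: eq_bigr => -[].
  by move=> S S'; rewrite !pairing => /gen.
have [card gap] := kjP (finfun f).
have := eP (finfun f); set k := (kj _).1 in card gap *; set j := (kj _).2 in gap *.
have sumE (h : A) (F : M -> R) : \sum_(x | finfun f x == h) F x = \sum_(x | f x == h) F x.
  by apply: eq_bigl => x; rewrite ffunE.
rewrite !sumE.
case: (fP k) => [|/(_ j)].
  rewrite leqNgt (eq_card (B := [pred x | finfun f x == k])) ?card // => x.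
  by rewrite !inE ffunE.
have up : \sum_(x | f x == j) c' (k, x) <= \sum_(x | f x == j) c k x + #|M|%:R * w.
  apply: (@le_trans _ _ (\sum_(x | f x == j) (c k x + w))).
    by apply: ler_sum => x _; have /andP[] := c'c (k, x).
  rewrite big_split /= lerD2l sumr_const -[leLHS]mulr_natl ler_wpM2r ?ler_nat ?max_card //.
  exact: ltW.
have down : \sum_(x | f x == k) c k x <= \sum_(x | f x == k) c' (k, x).
  by apply: ler_sum => x _; have /andP[] := c'c (k, x).
have small : 2 * (#|M|%:R * w) < e.
  by rewrite /w !mulrA ltr_pdivrMr // -natr1; lra.
lra.
Qed.

End Existence.

(** * From assignments to PMMS allocations and the optimal factor *)

Section PMMS.
Variables (R : realType) (I : instance R).
Implicit Types (i j : agent I) (S : {set chore I}).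

Let c i x := cost i [set x].

Lemma mu2_witness i S : exists2 P, is_bipartition S P & mu2 i S = bipartition_cost i P.
Proof.
rewrite /mu2; case: arg_minP => [|P PS _]; last by exists P.
by rewrite /is_bipartition /= setU0 eqxx disjoint_sym disjoints_subset sub0set.
Qed.

Lemma cost_le_mu2 i S x : x \in S -> c i x <= mu2 i S.
Proof.
have [[P1 P2] /andP[/eqP <- _] -> /=] := mu2_witness i S.
have part (P : {set chore I}) : x \in P -> c i x <= cost i P.
  move=> xP; rewrite (cost_additive i P) (bigD1 x) //= lerDl.
  by apply: sumr_ge0 => y _; apply: cost_ge0.
by rewrite inE /bipartition_cost le_max /= => /orP[] /part ->; rewrite ?orbT.
Qed.

Lemma cost_setU i S (S' : {set chore I}) :
  [disjoint S & S'] -> cost i (S :|: S') = cost i S + cost i S'.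
Proof.
move=> dis; rewrite (cost_additive i S) (cost_additive i S') -bigU //= cost_additive.
by apply: eq_bigl => x; rewrite !inE.
Qed.

Lemma half_cost_le_mu2 i S : cost i S <= 2 * mu2 i S.
Proof.
have [[P1 P2] /andP[/= /eqP <- dis] ->] := mu2_witness i S.
rewrite cost_setU // /bipartition_cost /=.
have : cost i P1 <= Num.max (cost i P1) (cost i P2) by rewrite le_max lexx.
have : cost i P2 <= Num.max (cost i P1) (cost i P2) by rewrite le_max lexx orbT.
lra.
Qed.

Lemma mu2_ge0 i S : 0 <= mu2 i S.
Proof. by have := half_cost_le_mu2 i S; have := cost_ge0 i S; lra. Qed.

Lemma exists_PMMS : exists X : bundles I, is_allocation X /\ is_PMMS (4 / 3) X.
Proof.
have [f fP] : exists f, single_or_2ef c f.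
  apply: exists_single_or_2ef; first exact: Ordinal (instance_agents_gt0 I).
  by move=> i x; apply: cost_ge0.
pose X : bundles I := [ffun i => [set x | f x == i]].
have XE i x : (x \in X i) = (f x == i) by rewrite ffunE inE.
have disX i j : i != j -> [disjoint X i & X j].
  move=> ij; rewrite disjoints_subset; apply/subsetP => x; rewrite inE !XE.
  by move/eqP->.
exists X; split.
  apply/andP; split; last first.
    by apply/forallP => i; apply/forallP => j; apply/implyP; apply: disX.
  rewrite -subTset; apply/subsetP => x _; apply/bigcupP; exists (f x) => //.
  by rewrite XE.
have costX i j : cost i (X j) = \sum_(x | f x == j) c i x.
  by rewrite cost_additive; apply: eq_bigl => x; rewrite XE.
move=> i j ij; have mu0 := mu2_ge0 i (X i :|: X j).
(* In the second case the union costs at least 3/2 of the own bundle, so [mu2] is at least 3/4 of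
   it. *)
case: (fP i) => [card|/(_ j)]; last first.
  rewrite -!costX; have := half_cost_le_mu2 i (X i :|: X j).
  by rewrite cost_setU ?disX //; lra.
have [x /= xX|X0] := pickP (mem (X i)); last first.
  rewrite cost_additive big1 => [|x]; first by rewrite mulr_ge0.
  by have := X0 x; rewrite /= => ->.
have mux : c i x <= mu2 i (X i :|: X j) by apply: cost_le_mu2; rewrite inE xX.
suff -> : cost i (X i) = c i x by lra.
congr (cost i); apply/esym/eqP; rewrite eqEcard sub1set xX cards1.
by rewrite (eq_card (B := [pred x | f x == i])) // => y; rewrite XE.
Qed.

Lemma opt_factor_le : opt_factor I <= 4 / 3.
Proof.
have [X [Xall Xpmms]] := exists_PMMS.
have triv : is_allocation (trivial_allocation I).
  apply/andP; split.
    rewrite -subTset; apply/subsetP => x _; apply/bigcupP.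
    by exists (Ordinal (instance_agents_gt0 I)) => //; rewrite ffunE eqxx inE.
  apply/forallP => i; apply/forallP => j; apply/implyP => ij.
  rewrite disjoints_subset !ffunE; case: eqP => [i0|_]; last exact: sub0set.
  by rewrite -i0 eq_sym (negbTE ij) setC0 subsetT.
rewrite /opt_factor; case: arg_minP => // Y _ /(_ X Xall) /le_trans; apply.
rewrite /PMMS_factor; apply/bigmax_leP; split; first by rewrite divr_ge0.
by move=> [i j] /= /andP[ij mu0]; rewrite ler_pdivrMr // Xpmms.
Qed.

End PMMS.

Theorem theorem8 (R : realType) :
  (forall I : instance R,
     exists X : bundles I, is_allocation X /\ is_PMMS (4 / 3) X)
  /\ (rho_star_PMMS R <= (4 / 3)%:E)%E.
Proof.
split; first exact: exists_PMMS.
by apply: ub_ereal_sup => _ [I ->]; rewrite lee_fin opt_factor_le.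
Qed.
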